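(* Consider the constrained problem $\min_{x\in X}f_0(x)$ subject to $f_i(x)\le0$, $i=1,\dots,m$, with optimal value $f_0^*$, as described in the context, and suppose that the strong duality, dual function smoothness (with constant $L$) and Slater assumptions stated in the context hold. Then for every accuracy $\epsilon>0$ (small) the inputs of the algorithm AR-CO (described in the context) can be chosen so that, with a computational complexity of $$\tilde{\mathcal O}\big(L/\sqrt\epsilon\big),$$ counted as the number of iterations of the algorithm (calls of LagOPT), it outputs an $\epsilon$-optimal solution $\tilde x$ with respect to both the optimality gap and the constraint violation, i.e. $$\mathbb E[f_0(\tilde x)]-f_0^*\le\epsilon\qquad\text{and}\qquad\|\mathbb E[f(\tilde x)]_+\|_1\le\epsilon.$$
   Context: **Problem.** $X\subseteq\mathbb R^n$ is a nonempty closed convex set and $f_0,\dots,f_m$ are (possibly nonconvex) real functions on $X$ with $|f_i(x)|\le G$ for all $x\in X$, $i=0,\dots,m$. $f(x):=(f_1(x),\dots,f_m(x))^\top$. The Lagrangian is $\mathcal L(x,\lambda):=f_0(x)+\sum_{i=1}^m\lambda_if_i(x)$, the dual function $d(\lambda):=\min_{x\in X}\mathcal L(x,\lambda)$, $d^*:=\max_{\lambda\in\mathbb R^m_+}d(\lambda)$. For $\mu>0$, $d_\mu(\lambda):=d(\lambda)-\frac\mu2\|\lambda\|_2^2$. $(\cdot)_+$ is the entrywise positive part ($\mathbb E[f(\tilde x)]_+$ is the positive part of the vector $\mathbb E[f(\tilde x)]$). **Strong duality.** $f_0^*=d^*$. **Dual function smoothness.** For each $\lambda\in\mathbb R^m_+$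 the Lagrangian has a unique minimizer $x^*_\lambda:=\operatorname{argmin}_{x\in X}\mathcal L(x,\lambda)$, $\nabla d(\lambda)=f(x^*_\lambda)$, and $\|\nabla d(\lambda)-\nabla d(\lambda')\|_2=\|f(x^*_\lambda)-f(x^*_{\lambda'})\|_2\le L\|\lambda-\lambda'\|_2$ for all $\lambda,\lambda'\in\mathbb R^m_+$. **Slater's condition.** There exist $\xi>0$ and $x_\xi\in X$ with $f_i(x_\xi)\le-\xi$ for all $i=1,\dots,m$. Put $B:=G/\xi$. **Algorithm AR-CO.** Inputs $T,\eta,\alpha,q,\mu,\delta$. Let $\Lambda:=\{\lambda\in\mathbb R^m_+:\lambda_i\le2B,\ i=1,\dots,m\}$ and $\lambda_0=\bar\lambda_0=0$. For $t=1,\dots,T$: $\underline\lambda_t=(1-q)\bar\lambda_{t-1}+q\lambda_{t-1}$; $x_t=\mathrm{LagOPT}(\delta,\underline\lambda_t)\in X$; $\widehat\nabla d_\mu(\underline\lambda_t)=f(x_t)-\mu\underline\lambda_t$; $\lambda_t=\operatorname{argmin}_{\lambda\in\Lambda}\{\eta[\langle-\widehat\nabla d_\mu(\underline\lambda_t),\lambda\rangle+\frac\mu2\|\lambda-\underline\lambda_t\|_2^2]+\frac12\|\lambda-\lambda_{t-1}\|_2^2\}$; $\bar\lambda_t=(1-\alpha)\bar\lambda_{t-1}+\alpha\lambda_t$. Output: $\tilde x=x_1$ with probability $(1-\alpha)^{T-1}$ and $\tilde x=x_i$ with probability $\alpha(1-\alpha)^{T-i}$ for $i=2,\dots,T$;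 expectations are over this choice. **LagOPT.** $\mathrm{LagOPT}(\delta,\lambda)$ is an optimizer that solves $\min_{x\in X}\mathcal L(x,\lambda)$ to any prescribed accuracy $\delta>0$, in the sense that the returned $x$ satisfies $|\mathcal L(x,\lambda)-d(\lambda)|\le\delta$ and $\|f(x)-f(x^*_\lambda)\|_2\le\delta$. $\tilde{\mathcal O}(\cdot)$ hides constants not depending on $\epsilon$ and factors logarithmic in $1/\epsilon$. *)

(* Defs.v *)
From HB Require Import structures.
From mathcomp Require Import all_boot all_order all_algebra.
From mathcomp Require Import all_classical all_reals all_analysis.

Set Implicit Arguments.
Unset Strict Implicit.
Unset Printing Implicit Defensive.

Import Order.TTheory GRing.Theory Num.Theory.
Import numFieldNormedType.Exports.

Local Open Scope classical_set_scope.
Local Open Scope ring_scope.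

Section Vectors.
Context {R : realType} {m : nat}.
Implicit Types u v : 'rV[R]_m.

Definition dotp u v : R := \sum_(i < m) u 0 i * v 0 i.

(* The norm `|v| supplied by the library on 'rV[R]_m is the sup norm, so the
   l1 and l2 norms are introduced separately. *)
Definition norm1 v : R := \sum_(i < m) `|v 0 i|.
Definition norm2 v : R := Num.sqrt (\sum_(i < m) v 0 i ^+ 2).

Definition pospart v : 'rV[R]_m := map_mx (Num.max 0) v.

Definition orthant : set 'rV[R]_m := [set v | forall i, 0 <= v 0 i].

Definition orthant_box (b : R) : set 'rV[R]_m :=
  [set v | orthant v /\ forall i, v 0 i <= b].

(* g is the gradient at v of h, regarded as a function on D only: at a boundary
   point of D just the increments that stay inside D are tested. *)
Definition is_gradient_on (D : set 'rV[R]_m) (h : 'rV[R]_m -> R) v g : Prop :=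
  forall e : R, 0 < e ->
    \forall u \near within D (nbhs v),
      `|h u - h v - dotp g (u - v)| <= e * norm2 (u - v).

End Vectors.

Section Argmin.
Context {R : realType} {n : nat}.

Definition is_minimizer (S : set 'rV[R]_n) (phi : 'rV[R]_n -> R) x : Prop :=
  S x /\ forall y, S y -> phi x <= phi y.

(* A chosen minimizer; it is only meaningful when one exists, and it is used
   only where the minimizer is unique. *)
Definition argmin (S : set 'rV[R]_n) (phi : 'rV[R]_n -> R) : 'rV[R]_n :=
  get (is_minimizer S phi).

End Argmin.

(* Only the values of [obj] and [con] on [dom] are ever used; [con x] is the
   vector (f_1(x), ..., f_m(x)). *)
Record problem (R : realType) (n m : nat) := Problem {
  dom : set 'rV[R]_n ;
  obj : 'rV[R]_n -> R ;
  con : 'rV[R]_n -> 'rV[R]_m }.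

Section Duality.
Context {R : realType} {n m : nat} (P : problem R n m).

Definition bounded_by (G : R) : Prop :=
  forall x, dom P x -> `|obj P x| <= G /\ forall i, `|con P x 0 i| <= G.

Definition feasible : set 'rV[R]_n :=
  [set x | dom P x /\ forall i, con P x 0 i <= 0].

Definition primal_value : R := inf (obj P @` feasible).

Definition lagrangian (x : 'rV[R]_n) (l : 'rV[R]_m) : R :=
  obj P x + dotp l (con P x).

Definition dual (l : 'rV[R]_m) : R := inf [set lagrangian x l | x in dom P].

Definition dual_value : R := sup (dual @` orthant).

Definition strong_duality : Prop := primal_value = dual_value.

Definition lag_argmin (l : 'rV[R]_m) : 'rV[R]_n :=
  argmin (dom P) (lagrangian^~ l).

Definition dual_smooth (L : R) : Prop :=
  [/\ forall l, orthant l ->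
        exists! x, is_minimizer (dom P) (lagrangian^~ l) x,
      forall l, orthant l ->
        is_gradient_on orthant dual l (con P (lag_argmin l))
    & forall l l', orthant l -> orthant l' ->
        norm2 (con P (lag_argmin l) - con P (lag_argmin l'))
          <= L * norm2 (l - l')].

Definition slater (xi : R) : Prop :=
  exists2 x, dom P x & forall i, con P x 0 i <= - xi.

Definition lagopt_spec (lagopt : R -> 'rV[R]_m -> 'rV[R]_n) : Prop :=
  forall (delta : R) (l : 'rV[R]_m), 0 < delta -> orthant l ->
    let x := lagopt delta l in
    [/\ dom P x,
        `|lagrangian x l - dual l| <= delta
      & norm2 (con P x - con P (lag_argmin l)) <= delta].

End Duality.

Record arco_inputs (R : realType) := ArcoInputs {
  inp_T : nat ;
  inp_eta : R ;
  inp_alpha : R ;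
  inp_q : R ;
  inp_mu : R ;
  inp_delta : R }.

Definition valid_inputs (R : realType) (a : arco_inputs R) : Prop :=
  [/\ (0 < inp_T a)%N, 0 < inp_eta a, 0 < inp_alpha a <= 1, 0 <= inp_q a <= 1
    & 0 < inp_mu a /\ 0 < inp_delta a].

Section ARCO.
Context {R : realType} {n m : nat} (P : problem R n m) (B : R).
Variables (lagopt : R -> 'rV[R]_m -> 'rV[R]_n) (a : arco_inputs R).

Definition arco_query (s : 'rV[R]_m * 'rV[R]_m) : 'rV[R]_m :=
  (1 - inp_q a) *: s.2 + inp_q a *: s.1.

Definition arco_step (s : 'rV[R]_m * 'rV[R]_m) : 'rV[R]_m * 'rV[R]_m :=
  let u := arco_query s in
  let g := con P (lagopt (inp_delta a) u) - inp_mu a *: u in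
  let l := argmin (orthant_box (2 * B)) (fun v =>
    inp_eta a * (dotp (- g) v + inp_mu a / 2 * norm2 (v - u) ^+ 2)
      + 2^-1 * norm2 (v - s.1) ^+ 2) in
  (l, (1 - inp_alpha a) *: s.2 + inp_alpha a *: l).

(* The pair (lambda_t, bar lambda_t). *)
Definition arco_state (t : nat) : 'rV[R]_m * 'rV[R]_m :=
  iter t arco_step (0, 0).

(* x_t, for t >= 1. *)
Definition arco_iterate (t : nat) : 'rV[R]_n :=
  lagopt (inp_delta a) (arco_query (arco_state t.-1)).

(* The probability that the output is x_t, for 1 <= t <= T. *)
Definition arco_weight (t : nat) : R :=
  if t == 1%N then (1 - inp_alpha a) ^+ (inp_T a).-1
  else inp_alpha a * (1 - inp_alpha a) ^+ (inp_T a - t).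

(* The expectation of h(output), over the random choice of the output. *)
Definition arco_expect (V : lmodType R) (h : 'rV[R]_n -> V) : V :=
  \sum_(1 <= t < (inp_T a).+1) arco_weight t *: h (arco_iterate t).

End ARCO.

(* Main.v *)
Require Import Defs.
From HB Require Import structures.
From mathcomp Require Import all_boot all_order all_algebra.
From mathcomp Require Import all_classical all_reals all_analysis.
From mathcomp Require Import ring lra.

Set Implicit Arguments.
Unset Strict Implicit.
Unset Printing Implicit Defensive.

Import Order.TTheory GRing.Theory Num.Theory.
Import numFieldNormedType.Exports.

Local Open Scope classical_set_scope.
Local Open Scope ring_scope.

(* At a query point u, the answer x of LagOPT gives the lower bound
   v |-> - lagrangian x v + mu / 2 * |v|^2 of the negated regularized dual function
   D(v) = - d(v) + mu / 2 * |v|^2.  Weak duality between u and the minimizer for v,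
   together with the Lipschitz bound on f(x*_v), shows that D exceeds this model by at
   most L * |v - u|^2 plus a multiple of delta; no gradient of d is needed.  With
   q = alpha, eta = alpha / ((1 - alpha) * mu) and 2 * L * alpha^2 <= (1 - alpha) * mu,
   the potential D(bar lambda_t) + mu / 2 * |lambda - lambda_t|^2 contracts by 1 - alpha
   up to alpha times the model of step t at lambda.  Unrolled, the models add up, with
   exactly the output probabilities as weights, to the expected Lagrangian: so
   E f_0 + <lambda, E f> - f_0^* is small for every lambda in the box.  Taking lambda = 0
   bounds the optimality gap; putting 2 B on the violated constraints, and comparing
   with a near-optimal multiplier from a smaller box, bounds the violation. *)

(** * Inner-product estimates and the proximal step on the box *)

Section DotProduct.
Context {R : realType} {m : nat}.
Implicit Types (u v w l : 'rV[R]_m) (c k : R).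

Lemma dotpC u v : dotp u v = dotp v u.
Proof. by apply: eq_bigr => i _; rewrite mulrC. Qed.

Lemma dotpDl u v w : dotp (u + v) w = dotp u w + dotp v w.
Proof. by rewrite -big_split; apply: eq_bigr => i _; rewrite mxE mulrDl. Qed.

Lemma dotpZl c u v : dotp (c *: u) v = c * dotp u v.
Proof. by rewrite mulr_sumr; apply: eq_bigr => i _; rewrite mxE mulrA. Qed.

Lemma dotpNl u v : dotp (- u) v = - dotp u v.
Proof. by rewrite -scaleN1r dotpZl mulN1r. Qed.

Lemma dotpDr u v w : dotp u (v + w) = dotp u v + dotp u w.
Proof. by rewrite !(dotpC u) dotpDl. Qed.

Lemma dotpZr c u v : dotp u (c *: v) = c * dotp u v.
Proof. by rewrite !(dotpC u) dotpZl. Qed.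

Lemma dotpNr u v : dotp u (- v) = - dotp u v.
Proof. by rewrite !(dotpC u) dotpNl. Qed.

Lemma dotp0l u : dotp 0 u = 0.
Proof. by rewrite -(scale0r u) dotpZl mul0r. Qed.

Definition dotpE := (dotpDl, dotpDr, dotpNl, dotpNr, dotpZl, dotpZr).

Lemma dotp_ge0 v : 0 <= dotp v v.
Proof. by apply: sumr_ge0 => i _; rewrite -expr2 sqr_ge0. Qed.

Lemma norm2_sqr v : norm2 v ^+ 2 = dotp v v.
Proof.
rewrite sqr_sqrtr; last by apply: sumr_ge0 => i _; rewrite sqr_ge0.
by apply: eq_bigr => i _; rewrite expr2.
Qed.

Lemma norm2_ge0 v : 0 <= norm2 v.
Proof. exact: sqrtr_ge0. Qed.

Lemma norm2N v : norm2 (- v) = norm2 v.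
Proof. by congr Num.sqrt; apply: eq_bigr => i _; rewrite mxE sqrrN. Qed.

Lemma dotp_eq0 v : dotp v v = 0 -> v = 0.
Proof.
move=> /eqP; rewrite psumr_eq0 => [/allP v0|i _]; last by rewrite -expr2 sqr_ge0.
apply/rowP => i; rewrite mxE; apply/eqP.
by have := v0 i (mem_index_enum i); rewrite /= mulf_eq0 orbb.
Qed.

(** Expanding [|u - k v|^2 >= 0] and bounding [|u|^2] by [k^2 |v|^2] does the work of
    Cauchy-Schwarz. *)
Lemma dotp_le_norm2 u v k : 0 < k -> norm2 u <= k * norm2 v ->
  dotp u v <= k * dotp v v.
Proof.
move=> k0 uv.
have : norm2 u ^+ 2 <= (k * norm2 v) ^+ 2.
  by rewrite lerXn2r ?nnegrE ?mulr_ge0 ?norm2_ge0 ?(ltW k0).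
rewrite exprMn !norm2_sqr => uu.
have := dotp_ge0 (u - k *: v); rewrite !dotpE (dotpC v u) => ge0.
rewrite -(ler_pM2l k0); nra.
Qed.

(** Same expansion; a bound quadratic in [v] can later be added to the Lipschitz term. *)
Lemma dotp_le_of_norm2_le u v k : 0 < k -> norm2 u <= k ->
  dotp u v <= k * (1 + dotp v v).
Proof.
move=> k0 uk.
have : norm2 u ^+ 2 <= k ^+ 2 by rewrite lerXn2r ?nnegrE ?norm2_ge0 ?(ltW k0).
rewrite norm2_sqr => uu.
have := dotp_ge0 (u - k *: v); rewrite !dotpE (dotpC v u) => ge0.
have := dotp_ge0 v => vv.
rewrite -(ler_pM2l k0); have := mulr_ge0 (sqr_ge0 k) vv; nra.
Qed.

Lemma box_orthant (b : R) v : orthant_box b v -> orthant v.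
Proof. by case. Qed.

Lemma box0 (b : R) : 0 <= b -> orthant_box b (0 : 'rV[R]_m).
Proof. by move=> b0; split=> i; rewrite mxE. Qed.

Lemma box_conv (b k : R) u v : 0 <= k <= 1 -> orthant_box b u ->
  orthant_box b v -> orthant_box b ((1 - k) *: u + k *: v).
Proof.
move=> /andP[k0 k1] [u0 ub] [v0 vb]; split=> i; rewrite !mxE.
  by have := u0 i; have := v0 i; nra.
by have := ub i; have := vb i; nra.
Qed.

Lemma dotp_box_sub (b : R) u v : orthant_box b u -> orthant_box b v ->
  dotp (u - v) (u - v) <= m%:R * b ^+ 2.
Proof.
move=> [u0 ub] [v0 vb].
rewrite mulrC mulr_natr -[m in leRHS]card_ord -sumr_const.
apply: ler_sum => i _; rewrite !mxE.
by have := u0 i; have := v0 i; have := ub i; have := vb i; nra.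
Qed.

Lemma dotp_box (b : R) u : orthant_box b u -> dotp u u <= m%:R * b ^+ 2.
Proof.
move=> ub; have b0 : orthant_box b (0 : 'rV[R]_m).
  by split=> i; rewrite mxE //; case: ub => u0 /(_ i); apply: le_trans.
by rewrite -[u in dotp u u]subr0; exact: dotp_box_sub.
Qed.

(** [argmin] is a choice among minimizers; strictness leaves a single candidate. *)
Lemma argmin_unique (n : nat) (S : set 'rV[R]_n) phi (x : 'rV[R]_n) :
  S x -> (forall y, S y -> y != x -> phi x < phi y) -> argmin S phi = x.
Proof.
move=> Sx xmin; apply: get_unique.
  split=> // y Sy; have [->//|yx] := eqVneq y x.
  by rewrite ltW ?xmin.
move=> y [Sy ymin]; apply/eqP; apply: contraT => yx.
by have := lt_le_trans (xmin y Sy yx) (ymin x Sx); rewrite ltxx.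
Qed.

(* The objective is [(eta * mu + 1) / 2 * |v - c|^2] up to a constant, so that its
   minimizer is the projection of [c] onto the box. *)
Lemma prox_box (b eta mu : R) g u s l : 0 <= b -> 0 < eta -> 0 < mu ->
  let phi v := eta * (dotp (- g) v + mu / 2 * norm2 (v - u) ^+ 2)
      + 2^-1 * norm2 (v - s) ^+ 2 in
  let p := argmin (orthant_box b) phi in
  orthant_box b p /\
  (orthant_box b l ->
    phi p + (eta * mu + 1) / 2 * dotp (l - p) (l - p) <= phi l).
Proof.
move=> b0 eta0 mu0 phi p.
pose A := eta * mu + 1.
have A0 : 0 < A by rewrite addr_gt0 ?mulr_gt0.
pose c := A^-1 *: (eta *: g + (eta * mu) *: u + s).
pose q : 'rV[R]_m := \row_i Num.min b (Num.max 0 (c 0 i)).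
have qb : orthant_box b q.
  by split=> i; rewrite mxE ?ge_min ?le_min ?b0 ?le_max lexx.
(* Exact expansion about [q]; that the right side is nonnegative is the variational inequality of
   the projection. *)
have phi_sub v : phi v - phi q - A / 2 * dotp (v - q) (v - q)
    = A * dotp (v - q) (q - c).
  have -> : dotp (v - q) (q - c)
    = dotp (v - q) q - A^-1 * (eta * dotp (v - q) g
         + eta * mu * dotp (v - q) u + dotp (v - q) s).
    by rewrite /c !dotpE; ring.
  rewrite /phi !norm2_sqr !dotpE (dotpC q v) (dotpC u v) (dotpC s v) (dotpC u q).
  rewrite (dotpC s q) (dotpC g v) (dotpC g q).
  rewrite /A; field; exact: lt0r_neq0.
(* Coordinatewise: where [q] differs from [c], it is the endpoint nearest to [c], and [v] is on the
   side away from [c]. *)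
have proj v : orthant_box b v -> 0 <= dotp (v - q) (q - c).
  move: c @q qb {phi_sub} => c q qb [v0 vb]; apply: sumr_ge0 => i _; rewrite !mxE.
  have := v0 i; have := vb i; move: (v 0 i) (c 0 i) => x y xb x0.
  rewrite minEle maxEle; case: (leP 0 y) => y0; case: (leP b _) => h.
  - by rewrite -mulrNN mulr_ge0 // oppr_ge0 subr_le0.
  - by rewrite subrr mulr0.
  - have -> : x = b by apply/le_anti; rewrite xb (le_trans h).
    by rewrite subrr mul0r.
  - by rewrite mulr_ge0 // subr_ge0 // ltW.
have main v : orthant_box b v -> phi q + A / 2 * dotp (v - q) (v - q) <= phi v.
  move=> /proj H; have := mulr_ge0 (ltW A0) H; rewrite -phi_sub; lra.
have -> : p = q.
  apply: argmin_unique => // v vb vq; apply: lt_le_trans (main v vb).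
  rewrite ltrDl mulr_gt0 ?divr_gt0 // lt_neqAle dotp_ge0 andbT eq_sym.
  by apply: contra_neq vq => /dotp_eq0 /eqP; rewrite subr_eq0 => /eqP.
by split=> // /main.
Qed.

End DotProduct.

(** * Weak duality, Slater bounds on multipliers, and the inexact oracle *)

Section Duality.
Context {R : realType} {n m : nat} (P : problem R n m) (G : R).
Hypotheses (P0 : dom P !=set0) (PG : bounded_by P G).
Implicit Types (l u v : 'rV[R]_m) (x : 'rV[R]_n).

Lemma bound_ge0 : 0 <= G.
Proof. by have [x /PG[xG _]] := P0; exact: le_trans xG. Qed.

Lemma lagrangian_bound x l : dom P x -> `|lagrangian P x l| <= G + G * norm1 l.
Proof.
move=> /PG[xG conG]; rewrite (le_trans (ler_normD _ _)) // lerD //.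
rewrite (le_trans (ler_norm_sum _ _ _)) // mulr_sumr; apply: ler_sum => i _.
by rewrite normrM mulrC ler_wpM2r.
Qed.

Lemma dual_le x l : dom P x -> dual P l <= lagrangian P x l.
Proof.
move=> Px; apply: ge_inf; last by exists x.
exists (- (G + G * norm1 l)) => _ [y Py <-].
by have := lagrangian_bound l Py; rewrite ler_norml => /andP[].
Qed.

Lemma dual0_ge : - G <= dual P 0.
Proof.
have [x0 Px0] := P0.
apply: lb_le_inf; first by exists (lagrangian P x0 0), x0.
move=> _ [y Py <-]; rewrite /lagrangian dotp0l addr0.
by have [] := PG Py; rewrite ler_norml => /andP[].
Qed.

(** Testing the Lagrangian at the Slater point bounds both the dual values and the size of any
    near-optimal multiplier. *)
Lemma dual_le_slater (xi : R) x l : 0 < xi -> dom P x ->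
  (forall i, con P x 0 i <= - xi) -> orthant l ->
  dual P l <= obj P x - xi * \sum_i l 0 i.
Proof.
move=> xi0 Px xneg l0; apply: (le_trans (dual_le l Px)).
rewrite lerD2l mulr_sumr -sumrN; apply: ler_sum => i _.
by have := l0 i; have := xneg i; nra.
Qed.

Lemma slater_has_sup_dual (xi : R) : 0 < xi -> slater P xi ->
  has_sup (dual P @` orthant).
Proof.
move=> xi0 [x Px xneg]; split; first by exists (dual P 0), 0 => // i; rewrite mxE.
exists G => _ [l l0 <-]; apply: (le_trans (dual_le_slater xi0 Px xneg l0)).
have [] := PG Px; rewrite ler_norml => /andP[_ xG] _.
have : 0 <= xi * \sum_i l 0 i by rewrite mulr_ge0 ?sumr_ge0 // ltW.
lra.
Qed.

Lemma dual_le_value (xi : R) l : 0 < xi -> slater P xi -> orthant l ->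
  dual P l <= dual_value P.
Proof.
move=> xi0 sl l0; apply: ub_le_sup; last by exists l.
by have [] := slater_has_sup_dual xi0 sl.
Qed.

(* Slater's condition bounds the l1 norm of an optimal multiplier only by
   [2 * G / xi], which is not interior to the box of the algorithm; but the bound is
   attained only if [dual_value P = - G], and then 0 is optimal. *)
Lemma near_optimal_multiplier (xi : R) : 0 < xi -> slater P xi ->
  exists2 c : R, 0 < c & forall e, 0 < e ->
    exists2 l, orthant_box (2 * (G / xi) - c) l & dual_value P - e <= dual P l.
Proof.
move=> xi0 sl; have [x Px xneg] := sl.
have [xG cG] := PG Px.
have xG' : obj P x <= G by move: xG; rewrite ler_norml => /andP[].
have d0 : orthant (0 : 'rV[R]_m) by move=> i; rewrite mxE.
have dv := dual_le_value xi0 sl d0.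
(* [g] is the slack in [f_0(x) - d* <= 2 G]. Half of it pays for the multiplier being only
   near-optimal, the other half becomes the margin [c]. *)
pose g := 2 * G - (obj P x - dual_value P).
have g0 : 0 <= g by have := dual0_ge; rewrite /g; lra.
have [geq|gneq] := eqVneq g 0.
  exists 1 => // e e0; exists 0; last first.
    by have := dual0_ge; move: geq; rewrite /g; lra.
  split=> // i; rewrite mxE subr_ge0.
  have : xi <= G.
    have := cG i; rewrite ler_norml => /andP[GG _].
    by have := xneg i; lra.
  by rewrite -{1}(mul1r xi) -(ler_pdivlMr _ _ xi0); lra.
have {gneq}g0 : 0 < g by rewrite lt_def gneq g0.
exists (g / 2 / xi) => [|e e0]; first by rewrite !divr_gt0.
have m0 : 0 < Num.min e (g / 2) by rewrite lt_min e0 divr_gt0.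
have [_ [l l0 <-] hl] := sup_adherent m0 (slater_has_sup_dual xi0 sl).
have me : Num.min e (g / 2) <= e by rewrite ge_min lexx.
have mg : Num.min e (g / 2) <= g / 2 by rewrite ge_min lexx orbT.
exists l; last by move: hl me; rewrite -/(dual_value P); lra.
split=> // i.
have hs := dual_le_slater xi0 Px xneg l0.
have li : l 0 i <= \sum_j l 0 j.
  by rewrite (bigD1 i) //= lerDl sumr_ge0.
rewrite -(ler_pM2l xi0).
have -> : xi * (2 * (G / xi) - g / 2 / xi) = 2 * G - g / 2 by field; rewrite gt_eqF.
apply: le_trans (_ : xi * \sum_j l 0 j <= _); first by rewrite ler_pM2l.
by move: hs hl mg; rewrite -/(dual_value P) /g; lra.
Qed.

(* Testing the constraint value [V] against the multiplier with entries [2 * B] on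
   the violated constraints beats every multiplier from the smaller box. *)
Lemma violation_le (B c F r : R) (V : 'rV[R]_m) :
    0 <= B ->
    (forall e, 0 < e ->
      exists2 l, orthant_box (2 * B - c) l & dual_value P - e <= dual P l) ->
    (forall l, orthant l -> dual P l <= F + dotp l V) ->
    (forall l, orthant_box (2 * B) l -> F + dotp l V - dual_value P <= r) ->
  c * norm1 (pospart V) <= r.
Proof.
move=> B0 near lower upper; apply/ler_addgt0Pr => e e0.
have [l [l0 lc] hl] := near e e0.
pose k : 'rV[R]_m := \row_i (if 0 < V 0 i then 2 * B else 0).
have kb : orthant_box (2 * B) k.
  by split=> i; rewrite mxE; case: ifP => // _; rewrite mulr_ge0.
have hk : dotp k V = 2 * B * norm1 (pospart V).
  rewrite mulr_sumr; apply: eq_bigr => i _; rewrite !mxE.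
  case: ltP => V0; last by rewrite normr0 mulr0 mul0r.
  by rewrite gtr0_norm.
have hlV : dotp l V <= (2 * B - c) * norm1 (pospart V).
  rewrite mulr_sumr; apply: ler_sum => i _; rewrite !mxE.
  have := l0 i; have := lc i; case: (ltP 0 (V 0 i)) => V0 h1 h2.
    by rewrite gtr0_norm // ler_wpM2r // ltW.
  by rewrite normr0 mulr0 mulr_ge0_le0.
have := upper k kb; have := lower l l0; rewrite hk.
move: hlV hl; nra.
Qed.

(* Comparing [dual u] with the Lagrangian at the minimizer for [v] turns the
   Lipschitz bound into the quadratic bound, with [L] in place of [L / 2]. *)
Lemma lagrangian_le_dual (L delta : R) x u v : 0 < L -> 0 < delta ->
    dual_smooth P L -> orthant u -> orthant v -> dom P x ->
    `|lagrangian P x u - dual P u| <= delta ->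
    norm2 (con P x - con P (lag_argmin P u)) <= delta ->
  lagrangian P x v
    <= dual P v + L * dotp (v - u) (v - u) + delta * (2 + dotp (v - u) (v - u)).
Proof.
move=> L0 d0 [uniq _ lip] u0 v0 Px xd xn.
have minP l : orthant l ->
    is_minimizer (dom P) (lagrangian P ^~ l) (lag_argmin P l).
  by move=> /uniq[y [ymin _]]; apply: (@getPex _ (is_minimizer _ _)); exists y.
have [Pu umin] := minP u u0; have [Pv vmin] := minP v v0.
have dv : lagrangian P (lag_argmin P v) v <= dual P v.
  apply: lb_le_inf.
    by exists (lagrangian P (lag_argmin P v) v), (lag_argmin P v).
  by move=> _ [y Py <-]; exact: vmin.
have du := dual_le u Pv.
(* The difference [f(x) - f(x*_v)] is split at [f(x*_u)]: the oracle error controls the first piece,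
   the Lipschitz bound the second. *)
have h1 := dotp_le_of_norm2_le (v - u) d0 xn.
have h2 : dotp (- (con P (lag_argmin P v) - con P (lag_argmin P u))) (v - u)
    <= L * dotp (v - u) (v - u).
  by apply: dotp_le_norm2 => //; rewrite norm2N; exact: lip.
move: xd; rewrite ler_norml => /andP[_ xd].
move: dv du h1 h2 xd; set q := dotp (v - u) (v - u).
rewrite /lagrangian !dotpE.
rewrite !(dotpC (con P _)); nra.
Qed.

End Duality.

(** * Output probabilities as the weights of an unrolled contraction *)

Section OutputWeights.
Context {R : realType}.
Implicit Types (k e : R) (F : nat -> R).

(** [arco_weight] with the rate and the horizon as arguments, so that induction on [T] is
    possible. *)
Definition output_weight k (T t : nat) : R :=
  if t == 1%N then (1 - k) ^+ T.-1 else k * (1 - k) ^+ (T - t).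

Lemma output_weight_ge0 k T t : 0 <= k <= 1 -> 0 <= output_weight k T t.
Proof.
move=> /andP[k0 k1]; have k1' : 0 <= 1 - k by rewrite subr_ge0.
by rewrite /output_weight; case: ifP => _; rewrite ?mulr_ge0 ?exprn_ge0.
Qed.

(** Positivity of [T] keeps the new index [T.+1] away from the exceptional index 1. *)
Lemma sum_output_weightS k T F : (0 < T)%N ->
  \sum_(1 <= t < T.+2) output_weight k T.+1 t * F t =
  (1 - k) * (\sum_(1 <= t < T.+1) output_weight k T t * F t) + k * F T.+1.
Proof.
move=> T0; rewrite big_nat_recr //= mulr_sumr; congr (_ + _).
  apply: eq_big_nat => t /andP[t1 tT]; rewrite mulrA; congr (_ * _).
  rewrite /output_weight; case: ifP => _; first by rewrite -exprS prednK.
  by rewrite subSn // exprS mulrCA.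
by rewrite /output_weight eqSS gtn_eqF // subnn expr0 mulr1.
Qed.

Lemma sum_output_weight k T : (0 < T)%N ->
  \sum_(1 <= t < T.+1) output_weight k T t = 1.
Proof.
case: T => // T _; elim: T => [|T IH]; first by rewrite big_nat1.
rewrite -[LHS](eq_bigr _ (fun t _ => mulr1 _)) sum_output_weightS //.
by under eq_bigr do rewrite mulr1; rewrite IH !mulr1 subrK.
Qed.

(** Unrolling gives [F 1] the weight [k * (1 - k) ^+ T.-1], which is [(1 - k) ^+ T] short of its
    output weight; hence the correction [- F 1]. The errors form a geometric series. *)
Lemma contraction_sum k e (phi F : nat -> R) T : 0 < k <= 1 -> 0 <= e ->
    (0 < T)%N ->
    (forall t, phi t.+1 <= (1 - k) * phi t + k * F t.+1 + e) ->
  phi T <= \sum_(1 <= t < T.+1) output_weight k T t * F t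
    + (1 - k) ^+ T * (phi 0%N - F 1%N) + e / k.
Proof.
move=> /andP[k0 k1] e0 + step; case: T => // T _.
elim: T => [|T IH].
  rewrite big_nat1 /output_weight /= expr0 expr1.
  have : e <= e / k by rewrite ler_pdivlMr // ler_piMr.
  by have := step 0%N; lra.
rewrite sum_output_weightS // exprS.
apply: (le_trans (step T.+1)).
(* [e / k] is the fixed point of the error recursion. *)
have -> : e / k = (1 - k) * (e / k) + e by field; rewrite gt_eqF.
have : (1 - k) * phi T.+1 <= (1 - k) *
    (\sum_(1 <= t < T.+2) output_weight k T.+1 t * F t
      + (1 - k) ^+ T.+1 * (phi 0%N - F 1%N) + e / k).
  by rewrite ler_wpM2l // subr_ge0.
lra.
Qed.

End OutputWeights.

(** * Potential decrease in one accelerated step, and the resulting rate *)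

(** [db] and [db'] stand for the dual values at [b] and [b'], and [v |-> F + dotp v g] for the
    Lagrangian at the oracle's answer. The proximal inequality is combined with the model bound at
    [b], weighted by [1 - al]. *)
Lemma accelerated_step {R : realType} {m : nat} (al mu eta L F e db db' : R)
    (g b s p l : 'rV[R]_m) :
  0 < al < 1 -> 0 < mu -> eta = al / ((1 - al) * mu) ->
  2 * L * al ^+ 2 <= (1 - al) * mu ->
  let u := (1 - al) *: b + al *: s in
  let b' := (1 - al) *: b + al *: p in
  let phi v := eta * (dotp (- (g - mu *: u)) v + mu / 2 * norm2 (v - u) ^+ 2)
      + 2^-1 * norm2 (v - s) ^+ 2 in
  phi p + (eta * mu + 1) / 2 * dotp (l - p) (l - p) <= phi l ->
  db <= F + dotp b g ->
  F + dotp b' g <= db' + L * dotp (b' - u) (b' - u) + e ->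
  - db' + mu / 2 * dotp b' b' + mu / 2 * dotp (l - p) (l - p)
  <= (1 - al) * (- db + mu / 2 * dotp b b + mu / 2 * dotp (l - s) (l - s))
     + al * (- (F + dotp l g) + mu / 2 * dotp l l) + e.
Proof.
move=> /andP[al0 al1] mu0 eta_eq small u b' phi prox hb hb'.
have al1' : 0 < 1 - al by rewrite subr_gt0.
have etaK : eta * ((1 - al) * mu) = al.
  by rewrite eta_eq divfK // mulf_neq0 // gt_eqF.
(* The terms linear in [mu *: u] cancel, so the query point drops out. *)
have {}prox : eta * (- dotp p g + mu / 2 * dotp p p) + 2^-1 * dotp (p - s) (p - s)
      + (eta * mu + 1) / 2 * dotp (l - p) (l - p)
    <= eta * (- dotp l g + mu / 2 * dotp l l) + 2^-1 * dotp (l - s) (l - s).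
  move: prox; rewrite /phi !norm2_sqr; move: u {b' phi hb hb'} => u.
  rewrite !dotpE (dotpC p l) (dotpC s l) (dotpC s p) (dotpC u l) (dotpC u p)
    (dotpC g l) (dotpC g p); lra.
(* Multiplying by [(1 - al) * mu] turns the coefficient of [|l - p|^2] into exactly [mu / 2]. *)
have {}prox : al * (- dotp p g + mu / 2 * dotp p p)
      + (1 - al) * mu / 2 * dotp (p - s) (p - s)
      + mu / 2 * dotp (l - p) (l - p)
    <= al * (- dotp l g + mu / 2 * dotp l l) + (1 - al) * mu / 2 * dotp (l - s) (l - s).
  have etaK' : eta * mu * al = eta * mu - al by rewrite -[in RHS]etaK; ring.
  have mulE A Q C : (eta * A + 2^-1 * Q + (eta * mu + 1) / 2 * C) * ((1 - al) * mu)
      = al * A + (1 - al) * mu / 2 * Q + mu / 2 * C by field: etaK'.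
  have mulE' A Q : (eta * A + 2^-1 * Q) * ((1 - al) * mu)
      = al * A + (1 - al) * mu / 2 * Q by field: etaK'.
  by have := ler_wpM2r (ltW (mulr_gt0 al1' mu0)) prox; rewrite mulE mulE'.
have b'u : b' - u = al *: (p - s).
  by rewrite /b' /u opprD addrACA subrr add0r scalerBr.
have conv : dotp b' b' <= (1 - al) * dotp b b + al * dotp p p.
  have := mulr_ge0 (ltW (mulr_gt0 al0 al1')) (dotp_ge0 (b - p)).
  rewrite /b' !dotpE (dotpC p b); nra.
(* The smallness of [al] lets the proximal term absorb the smoothness error. *)
have quad : L * dotp (b' - u) (b' - u) <= (1 - al) * mu / 2 * dotp (p - s) (p - s).
  by rewrite b'u !dotpZl !dotpZr; have := ler_wpM2r (dotp_ge0 (p - s)) small; nra.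
have b'g : dotp b' g = (1 - al) * dotp b g + al * dotp p g by rewrite !dotpE.
have {}conv := ler_wpM2l (ltW mu0) conv.
have {}hb := ler_wpM2l (ltW al1') hb.
move: hb' quad; rewrite b'g; set q := L * _; nra.
Qed.

Section AcceleratedRate.
Context {R : realType} {n m : nat} (P : problem R n m) (G B L xi : R).
Variables (lagopt : R -> 'rV[R]_m -> 'rV[R]_n) (a : arco_inputs R).
Hypotheses (P0 : dom P !=set0) (PG : bounded_by P G) (B0 : 0 <= B).
Hypotheses (L0 : 0 < L) (PL : dual_smooth P L).
Hypotheses (xi0 : 0 < xi) (sl : slater P xi) (opt : lagopt_spec P lagopt).

Let alpha := inp_alpha a.
Let mu := inp_mu a.
Let delta := inp_delta a.
Let T := inp_T a.

Hypotheses (T0 : (0 < T)%N) (alpha01 : 0 < alpha < 1).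
Hypotheses (mu0 : 0 < mu) (delta0 : 0 < delta).
Hypothesis q_eq : inp_q a = alpha.
Hypothesis eta_eq : inp_eta a = alpha / ((1 - alpha) * mu).
Hypothesis alpha_small : 2 * L * alpha ^+ 2 <= (1 - alpha) * mu.

Let state := arco_state P B lagopt a.
Let iter t := arco_iterate P B lagopt a t.
Let D v := - dual P v + mu / 2 * dotp v v.
(* A global lower bound of [D], touching it up to [delta] at the query point if [x]
   is the answer of [lagopt]. *)
Let model x v := - lagrangian P x v + mu / 2 * dotp v v.
Let err := delta * (2 + m%:R * (2 * B) ^+ 2).

Let eta0 : 0 < inp_eta a.
Proof.
by have /andP[? ?] := alpha01; rewrite eta_eq divr_gt0 // mulr_gt0 // subr_gt0.
Qed.

Lemma query_box (s : 'rV[R]_m * 'rV[R]_m) :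
  orthant_box (2 * B) s.1 -> orthant_box (2 * B) s.2 ->
  orthant_box (2 * B) (arco_query a s).
Proof.
by move=> s1 s2; have /andP[? ?] := alpha01; apply: box_conv; rewrite // q_eq !ltW.
Qed.

Lemma state_box t :
  orthant_box (2 * B) (state t).1 /\ orthant_box (2 * B) (state t).2.
Proof.
have b0 : 0 <= 2 * B by rewrite mulr_ge0.
elim: t => [|t [IH1 IH2]]; first by split; exact: box0.
rewrite /state /arco_state iterS /= -/(arco_state P B lagopt a t) -/(state t).
set p := argmin _ _.
have pb : orthant_box (2 * B) p by exact: (prox_box _ _ _ 0 b0 eta0 mu0).1.
by split=> //; have /andP[? ?] := alpha01; apply: box_conv; rewrite // !ltW.
Qed.

Lemma query_orthant t : orthant (arco_query a (state t)).
Proof. by have [s1 s2] := state_box t; apply: box_orthant (query_box s1 s2). Qed.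

Lemma iter_dom t : dom P (iter t).
Proof. by have [] := opt delta0 (query_orthant t.-1). Qed.

Lemma arco_step_decrease l t : orthant_box (2 * B) l ->
  D (state t.+1).2 + mu / 2 * dotp (l - (state t.+1).1) (l - (state t.+1).1)
  <= (1 - alpha) * (D (state t).2
        + mu / 2 * dotp (l - (state t).1) (l - (state t).1))
     + alpha * model (iter t.+1) l + err.
Proof.
move=> lb; have [s1b s2b] := state_box t; have [_ s2b'] := state_box t.+1.
have ub := query_box s1b s2b; have u0 := query_orthant t.
have [xdom xlag xcon] := opt delta0 u0.
have /andP[al0 al1] := alpha01.
have b0 : 0 <= 2 * B by rewrite mulr_ge0.
have smooth := lagrangian_le_dual PG L0 delta0 PL u0 (box_orthant s2b') xdom xlag xcon.
have diam := dotp_box_sub s2b' ub.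
have [_ /(_ lb)] := prox_box
  (con P (iter t.+1) - mu *: arco_query a (state t))
  (arco_query a (state t)) (state t).1 l b0 eta0 mu0.
rewrite -[argmin _ _]/((state t.+1).1) => prox.
have hb := dual_le PG (state t).2 xdom.
have b'E : (state t.+1).2 = (1 - alpha) *: (state t).2 + alpha *: (state t.+1).1 by [].
have qE : arco_query a (state t) = (1 - alpha) *: (state t).2 + alpha *: (state t).1.
  by rewrite /arco_query q_eq.
(* The box diameter makes the oracle error a constant, independent of [t]. *)
have {}smooth : lagrangian P (iter t.+1) (state t.+1).2 <= dual P (state t.+1).2
   + L * dotp ((state t.+1).2 - arco_query a (state t))
       ((state t.+1).2 - arco_query a (state t)) + err.
  apply: (le_trans smooth); rewrite lerD2l ler_pM2l // lerD2l; exact: diam.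
move: prox hb smooth; rewrite -[lagopt _ _]/(iter t.+1) /D b'E qE.
move: (iter t.+1) (state t.+1).1 (state t).2 (state t).1 => x p b s.
exact: accelerated_step.
Qed.

Lemma expect_obj : arco_expect P B lagopt a (obj P : _ -> R^o) =
  \sum_(1 <= t < T.+1) output_weight alpha T t * obj P (iter t).
Proof. by []. Qed.

Lemma expect_dotp l : dotp l (arco_expect P B lagopt a (con P)) =
  \sum_(1 <= t < T.+1) output_weight alpha T t * dotp l (con P (iter t)).
Proof.
rewrite /arco_expect; elim/big_ind2: _ => [|x y z w <- <-|t _].
- by rewrite dotpC dotp0l.
- by rewrite dotpDr.
- by rewrite dotpZr.
Qed.

Lemma expect_lagrangian l :
  arco_expect P B lagopt a (obj P : _ -> R^o)
    + dotp l (arco_expect P B lagopt a (con P)) =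
  \sum_(1 <= t < T.+1) output_weight alpha T t * lagrangian P (iter t) l.
Proof.
by rewrite expect_obj expect_dotp -big_split; apply: eq_bigr => t _ /=; rewrite -mulrDr.
Qed.

(** Weak duality at each iterate survives averaging, the weights being nonnegative with sum 1. *)
Lemma dual_le_expect l :
  dual P l <= arco_expect P B lagopt a (obj P : _ -> R^o)
    + dotp l (arco_expect P B lagopt a (con P)).
Proof.
have /andP[al0 al1] := alpha01.
rewrite expect_lagrangian -[leLHS]mul1r -(sum_output_weight alpha T0) mulr_suml.
apply: ler_sum => t _; rewrite ler_wpM2l ?output_weight_ge0 ?(ltW al0) ?(ltW al1) //.
exact: (dual_le PG l (iter_dom t)).
Qed.

Lemma arco_gap l : orthant_box (2 * B) l ->
  arco_expect P B lagopt a (obj P : _ -> R^o)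
    + dotp l (arco_expect P B lagopt a (con P)) - dual_value P
  <= mu / 2 * (m%:R * (2 * B) ^+ 2)
     + (1 - alpha) ^+ T * (2 * G + 2 * G * B * m%:R) + err / alpha.
Proof.
move=> lb; have /andP[al0 al1] := alpha01.
have err0 : 0 <= err.
  by rewrite mulr_ge0 ?(ltW delta0) // addr_ge0 // mulr_ge0 ?sqr_ge0.
pose phi t := D (state t).2
  + mu / 2 * dotp (l - (state t).1) (l - (state t).1).
have := @contraction_sum _ alpha err phi (fun t => model (iter t) l) T.
rewrite al0 (ltW al1) => /(_ isT err0 T0 (fun t => arco_step_decrease t lb)).
have -> : \sum_(1 <= t < T.+1) output_weight alpha T t * model (iter t) l =
   mu / 2 * dotp l l - (arco_expect P B lagopt a (obj P : _ -> R^o)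
    + dotp l (arco_expect P B lagopt a (con P))).
  rewrite expect_lagrangian; move: (sum_output_weight alpha T0).
  rewrite /model; move: (mu / 2 * dotp l l) => c sum1.
  rewrite -[c in RHS]mul1r -sum1 mulr_suml -sumrN -big_split.
  by apply: eq_bigr => t _ /=; rewrite mulrDr mulrN addrC.
have phiT : - dual_value P <= phi T.
  have [_ sb] := state_box T.
  have := dual_le_value PG xi0 sl (box_orthant sb).
  have := mulr_ge0 (divr_ge0 (ltW mu0) (ler0n R 2)) (dotp_ge0 (state T).2).
  have := mulr_ge0 (divr_ge0 (ltW mu0) (ler0n R 2)) (dotp_ge0 (l - (state T).1)).
  rewrite /phi /D; lra.
have norm1l : norm1 l <= m%:R * (2 * B).
  case: lb => l0 l1; rewrite mulrC mulr_natr -[m in leRHS]card_ord -sumr_const.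
  by apply: ler_sum => i _; rewrite ger0_norm.
(* As [lambda_0 = 0], the initial distance term cancels the regularizer of the model. *)
have phi0 : phi 0%N - model (iter 1) l <= 2 * G + 2 * G * B * m%:R.
  have := lagrangian_bound PG l (iter_dom 1); rewrite ler_norml => /andP[_].
  have := dual0_ge P0 PG.
  have := ler_wpM2l (bound_ge0 P0 PG) norm1l.
  rewrite /phi /D /model /= subr0 dotp0l; lra.
have := ler_wpM2l (exprn_ge0 T (_ : 0 <= 1 - alpha)) phi0.
rewrite subr_ge0 (ltW al1) => /(_ isT) {}phi0.
have := ler_wpM2l (divr_ge0 (ltW mu0) (ler0n R 2)) (dotp_box lb).
lra.
Qed.

End AcceleratedRate.

(* [mu] is of order [eps], [al] of order [sqrt (mu / L)], and the number of steps of
   order [ln (1 / eps) / al]; as [eps0] may depend on all the constants, the second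
   logarithm absorbs them. *)
Lemma rate_parameters {R : realType} (L M K c : R) :
  0 < L -> 1 <= M -> 1 <= K -> 0 < c <= 1 ->
  exists2 eps0 : R, 0 < eps0 & forall eps : R, 0 < eps < eps0 ->
  exists (T : nat) (al mu delta : R),
    [/\ (0 < T)%N, 0 < al < 1, 0 < mu & 0 < delta] /\
    [/\ 2 * L * al ^+ 2 <= (1 - al) * mu,
        mu / 2 * M + (1 - al) ^+ T * K + delta * M / al <= c * eps
      & T%:R <= L / Num.sqrt eps * ln (eps^-1) ^+ 2].
Proof.
move=> L0 M1 K1 /andP[c0 c1].
have M0 : 0 < M by apply: lt_le_trans M1.
have K0 : 0 < K by apply: lt_le_trans K1.
(* Chosen so that [al = sqrt eps / A] satisfies [4 * L * al ^+ 2 = mu]. *)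
pose A := Num.sqrt (12 * L * M / c).
have arg0 : 0 < 12 * L * M / c by rewrite divr_gt0 ?mulr_gt0.
have A0 : 0 < A by rewrite sqrtr_gt0.
have A2 : A ^+ 2 = 12 * L * M / c by rewrite sqr_sqrtr // ltW.
pose Q := ln (3 * K / c).
have Q0 : 0 <= Q by rewrite ln_ge0 // ler_pdivlMr //; lra.
(* Once [ln (1 / eps)] exceeds [W], it dominates both [1 + Q] and the constant [(2 * A + 1) / L]
   left over in the step count. *)
pose W := 1 + Q + (2 * A + 1) / L.
have AL0 : 0 < (2 * A + 1) / L by rewrite divr_gt0 // addr_gt0 // mulr_gt0.
exists (Num.min L (expR (- W))) => [|eps /andP[e0]]; first by rewrite lt_min L0 expR_gt0.
rewrite lt_min => /andP[eL eW].
pose s := Num.sqrt eps.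
have s0 : 0 < s by rewrite sqrtr_gt0.
have s2 : s ^+ 2 = eps by rewrite sqr_sqrtr // ltW.
pose ell := ln (eps^-1).
have ellW : W < ell.
  rewrite /ell lnV ?posrE // ltrNr -[- W]expRK ltr_ln ?posrE //; exact: expR_gt0.
have e1 : eps < 1.
  by apply: lt_trans eW _; rewrite -[ltRHS]expR0 ltr_expR oppr_lt0 /W; lra.
have s1 : s <= 1 by rewrite -[leRHS]sqrtr1 ler_wsqrtr // ltW.
pose mu := c * eps / (3 * M).
have mu0 : 0 < mu by rewrite divr_gt0 // mulr_gt0.
pose al := s / A.
have al0 : 0 < al by rewrite divr_gt0.
have al2 : 4 * L * al ^+ 2 = mu.
  rewrite /al expr_div_n s2 A2 /mu; field; rewrite ?gt_eqF //.
have muL : mu < L.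
  rewrite /mu ltr_pdivrMr ?mulr_gt0 //.
  apply: le_lt_trans (_ : eps < _); first by rewrite ler_piMl // ltW.
  apply: (lt_le_trans eL); rewrite ler_peMr ?(ltW L0) //; lra.
have al12 : al < 1 / 2.
  have : 4 * L * al ^+ 2 < L by rewrite al2.
  rewrite mulrAC gtr_pMl // => h; nra.
pose delta := al * (c * eps) / (3 * M).
(* With this [X], [expR (- X) * K] is one third of the target [c * eps]. *)
pose X := ln (3 * K / (c * eps)).
have XE : X = Q + ell.
  rewrite /X /Q /ell -lnM ?posrE ?invr_gt0 ?divr_gt0 ?mulr_gt0 //.
  by congr ln; field; rewrite !gt_eqF.
have X0 : 0 <= X by rewrite XE; move: ellW; rewrite /W; lra.
(* The successor gives both [X / al < T] and [0 < T]. *)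
pose T := (Num.truncn (X / al)).+1.
exists T, al, mu, delta; split.
  split=> //; first by apply/andP; split=> //; lra.
  by rewrite divr_gt0 // mulr_gt0 // mulr_gt0.
split.
- by rewrite -al2; have := mulr_ge0 (ltW L0) (sqr_ge0 al); nra.
- have -> : mu / 2 * M = c * eps / 6 by rewrite /mu; field; rewrite gt_eqF.
  have -> : delta * M / al = c * eps / 3 by rewrite /delta; field; rewrite !gt_eqF.
  suff : (1 - al) ^+ T * K <= c * eps / 3 by have := mulr_gt0 c0 e0; lra.
  have step : (1 - al) ^+ T <= expR (- X).
    apply: (@le_trans _ _ (expR (- al) ^+ T)).
      by rewrite lerXn2r ?nnegrE ?expR_ge0 ?expR_ge1Dx //; lra.
    rewrite -expRM_natl ler_expR mulrN lerN2 -ler_pdivrMr //.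
    by rewrite ltW // truncnS_gt.
  apply: (le_trans (ler_wpM2r (ltW K0) step)).
  rewrite expRN lnK ?posrE ?divr_gt0 ?mulr_gt0 //.
  suff -> : (3 * K / (c * eps))^-1 * K = c * eps / 3 by [].
  by field; rewrite !gt_eqF.
- have TX : T%:R <= X / al + 1.
    by rewrite /T -natr1 lerD2r truncn_le divr_ge0 // ltW.
  apply: (le_trans TX).
  have -> : X / al = X * A / s by rewrite /al invf_div mulrA.
  rewrite -/s -/ell -(ler_pM2r s0) mulrDl mul1r divfK ?gt_eqF //.
  rewrite mulrAC divfK ?gt_eqF //.
  have ell1 : 1 <= ell by move: ellW; rewrite /W; lra.
  have h1 : X * A + s <= ell * (2 * A + 1).
    have : X <= 2 * ell by rewrite XE; move: ellW; rewrite /W; lra.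
    by move=> /(ler_wpM2r (ltW A0)) /=; lra.
  apply: (le_trans h1).
  have ell0 : 0 < ell by apply: lt_le_trans ell1.
  rewrite expr2 mulrCA ler_pM2l // [leRHS]mulrC -ler_pdivrMr //.
  by move: ellW; rewrite /W; lra.
Qed.

Theorem corollary2 (R : realType) (m : nat) (G xi L0 : R)
    (xi_gt0 : 0 < xi) (L0_gt0 : 0 < L0) :
  exists (C : R) (k : nat), 0 < C /\
  forall (n : nat) (P : problem R n m) (L : R),
    dom P !=set0 -> closed (dom P) -> convex_set (dom P) ->
    bounded_by P G ->
    strong_duality P ->
    L0 <= L -> dual_smooth P L ->
    slater P xi ->
  exists2 eps0 : R, 0 < eps0 & forall eps : R, 0 < eps < eps0 ->
  exists2 a : arco_inputs R, valid_inputs a &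
    (inp_T a)%:R <= C * (L / Num.sqrt eps) * ln (eps^-1) ^+ k /\
    forall lagopt : R -> 'rV[R]_m -> 'rV[R]_n, lagopt_spec P lagopt ->
      arco_expect P (G / xi) lagopt a (obj P : _ -> R^o) - primal_value P
        <= eps /\
      norm1 (pospart (arco_expect P (G / xi) lagopt a (con P))) <= eps.
Proof.
exists 1, 2%N; split=> // n P L P0 _ _ PG duality L0L PL sl.
have L_gt0 : 0 < L by apply: lt_le_trans L0L.
pose B := G / xi.
have G0 := bound_ge0 P0 PG.
have B0 : 0 <= B := divr_ge0 G0 (ltW xi_gt0).
have [c c0 near] := near_optimal_multiplier P0 PG xi_gt0 sl.
(* The oracle error is [delta * M], and [M] also dominates the regularization term; the summand 1 in
   [K] keeps the logarithm in the step count under control. *)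
pose M := 2 + m%:R * (2 * B) ^+ 2.
pose K := 2 * G + 2 * G * B * m%:R + 1.
have mB0 : 0 <= m%:R * (2 * B) ^+ 2 by rewrite mulr_ge0 ?sqr_ge0.
have GB0 : 0 <= 2 * G * B * m%:R by rewrite mulr_ge0 // mulr_ge0 // mulr_ge0.
have M1 : 1 <= M by rewrite /M; lra.
have K1 : 1 <= K by rewrite /K; lra.
(* The target is [Num.min c 1 * eps]: the factor [c] is lost in the violation bound, and the cap 1
   serves the optimality gap. *)
have c'1 : 0 < Num.min c 1 <= 1 by rewrite lt_min c0 ltr01 ge_min lexx orbT.
have [eps0 eps0_gt0 params] := rate_parameters L_gt0 M1 K1 c'1.
exists eps0 => // eps epsP; have /andP[e0 _] := epsP.
have [T [al [mu [delta [[T0 alP mu0 delta0] [small total TP]]]]]] := params eps epsP.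
have /andP[al0 al1] := alP.
pose a := ArcoInputs T (al / ((1 - al) * mu)) al al mu delta.
exists a.
  split=> //=; first by rewrite divr_gt0 // mulr_gt0 // subr_gt0.
    by rewrite al0 ltW.
  by rewrite !ltW.
split; first by rewrite mul1r.
move=> lagopt opt.
have gap l : orthant_box (2 * B) l ->
    arco_expect P B lagopt a (obj P : _ -> R^o)
      + dotp l (arco_expect P B lagopt a (con P)) - dual_value P
    <= Num.min c 1 * eps.
  move=> lb.
  apply: le_trans (@arco_gap _ _ _ P G B L xi lagopt a P0 PG B0 L_gt0 PL xi_gt0
    sl opt T0 alP mu0 delta0 erefl erefl small l lb) _.
  apply: le_trans total; rewrite -/M /= lerD2r lerD //.
    by rewrite ler_wpM2l ?divr_ge0 ?(ltW mu0) // /M lerDr.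
  by rewrite ler_wpM2l ?exprn_ge0 ?subr_ge0 ?(ltW al1) // /K lerDl.
have c'c : Num.min c 1 <= c by rewrite ge_min lexx.
have /andP[c'0 c'le1] := c'1.
split.
  have := gap 0 (box0 (mulr_ge0 (ler0n _ 2) B0)).
  rewrite dotp0l addr0 duality => /le_trans; apply.
  by rewrite ler_piMl // ltW.
have := violation_le B0 near _ gap.
have lower l : orthant l -> dual P l <= arco_expect P B lagopt a (obj P : _ -> R^o)
      + dotp l (arco_expect P B lagopt a (con P)).
  move=> _; exact: (@dual_le_expect _ _ _ P G B lagopt a PG B0 opt T0 alP mu0
    delta0 erefl erefl).
move=> /(_ lower) viol.
rewrite -(ler_pM2l c'0); apply: le_trans viol.
by rewrite ler_wpM2r // sumr_ge0.
Qed.
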